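(* Let $(\Omega,\mathscr H,\hat{\mathbb E})$ be a sub-linear expectation space, let $\mathscr H_{n,0}\subset\cdots\subset\mathscr H_{n,k_n}$ be subspaces of $\mathscr H$ and $\hat{\mathbb E}_{n,k}=\hat{\mathbb E}[\,\cdot\,|\mathscr H_{n,k}]$, $k=0,\dots,k_n$, be conditional expectation operators satisfying properties (a) and (b) of the context. Let $\{Z_{n,k};k=1,\dots,k_n\}$ be an array of random variables such that $Z_{n,k}\in\mathscr H_{n,k}$ and $\hat{\mathbb E}[Z_{n,k}^2]<\infty$, $k=1,\dots,k_n$. Assume that $\hat{\mathbb E}[Z_{n,k}|\mathscr H_{n,k-1}]\le0$ in $L_1$, $k=1,\dots,k_n$. Then for all $x,y,A>0$, $$\mathbb V\Big(\max_{m\le k_n}\sum_{k=1}^mZ_{n,k}\ge x\Big)\le\mathbb V\Big(\max_{k\le k_n}Z_{n,k}\ge y\ \text{ or }\ \sum_{k=1}^{k_n}\hat{\mathbb E}[Z_{n,k}^2|\mathscr H_{n,k-1}]\ge A\Big)+\exp\left\{-\frac{x^2}{2(xy+A)}\Big(1+\frac23\ln\big(1+\frac{xy}A\big)\Big)\right\}.$$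
   Context: Sub-linear expectation space: Let $(\Omega,\mathcal F)$ be a measurable space and $\mathscr H$ a linear space of real functions on $(\Omega,\mathcal F)$ (called random variables) such that $X_1,\dots,X_n\in\mathscr H$ implies $\varphi(X_1,\dots,X_n)\in\mathscr H$ for each $\varphi\in C_{l,Lip}(\mathbb R^n)$. Here $C_{l,Lip}(\mathbb R^n)$ is the space of functions satisfying $|\varphi(x)-\varphi(y)|\le C(1+|x|^m+|y|^m)|x-y|$ for all $x,y\in\mathbb R^n$, for some $C>0$, $m\in\mathbb N$ depending on $\varphi$. A sub-linear expectation is a function $\hat{\mathbb E}:\mathscr H\to[-\infty,\infty]$ such that for all $X,Y\in\mathscr H$: (1) $X\ge Y$ implies $\hat{\mathbb E}[X]\ge\hat{\mathbb E}[Y]$; (2) $\hat{\mathbb E}[c]=c$ for constants $c$; (3) $\hat{\mathbb E}[X+Y]\le\hat{\mathbb E}[X]+\hat{\mathbb E}[Y]$ whenever the right side is not of the form $+\infty-\infty$ or $-\infty+\infty$; (4) $\hat{\mathbb E}[\lambda X]=\lambda\hat{\mathbb E}[X]$ for $\lambda\ge0$. If a function $X$ on $\Omega$ is not in $\mathscr H$, $\hat{\mathbb E}[X]$ denotes $\inf\{\hat{\mathbb E}[Y]:X\le Y\in\mathscr H\}$. The capacity is $\mathbb V(A)=\inf\{\hat{\mathbb E}[\xi]:I_A\le\xi,\ \xi\in\mathscr H\}$, $A\in\mathcal F$. Notation: $x^+=\max(x,0)$, $x^-=\max(-x,0)$. Conditional expectations: write $X\le Y$ in $L_p$ if $\hat{\mathbb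 E}[((X-Y)^+)^p]=0$, and $X=Y$ in $L_p$ if both $X\le Y$ and $Y\le X$ in $L_p$. Each $\mathscr H_{n,k}$ contains the constants and satisfies: $X_1,\dots,X_d\in\mathscr H_{n,k}$ implies $\varphi(X_1,\dots,X_d)\in\mathscr H_{n,k}$ for all $\varphi\in C_{l,Lip}(\mathbb R^d)$. Put $\mathscr L(\mathscr H)=\{X\in\mathscr H:\hat{\mathbb E}[|X|]<\infty\}$ and similarly $\mathscr L(\mathscr H_{n,k})$. The operators are maps $\hat{\mathbb E}_{n,k}:\mathscr L(\mathscr H)\to\mathscr L(\mathscr H_{n,k})$; one writes $\hat{\mathbb E}[X|\mathscr H_{n,k}]=\hat{\mathbb E}_{n,k}[X]$. Properties, for all $X,Y\in\mathscr L(\mathscr H)$: (a) $\hat{\mathbb E}_{n,k}[X+Y]=X+\hat{\mathbb E}_{n,k}[Y]$ in $L_1$ if $X\in\mathscr H_{n,k}$; and $\hat{\mathbb E}_{n,k}[XY]=X^+\hat{\mathbb E}_{n,k}[Y]+X^-\hat{\mathbb E}_{n,k}[-Y]$ in $L_1$ if $X\in\mathscr H_{n,k}$ and $XY\in\mathscr L(\mathscr H)$; (b) $\hat{\mathbb E}[\hat{\mathbb E}_{n,k}[X]]=\hat{\mathbb E}[X]$. *)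

(* Defs.v *)
From HB Require Import structures.
From mathcomp Require Import all_boot all_order all_algebra.
From mathcomp Require Import all_classical all_reals all_analysis.

Set Implicit Arguments.
Unset Strict Implicit.
Unset Printing Implicit Defensive.

Import Order.TTheory GRing.Theory Num.Theory.

Local Open Scope classical_set_scope.
Local Open Scope ring_scope.

Definition eucl_norm (R : realType) (n : nat) (x : 'rV[R]_n) : R :=
  Num.sqrt (\sum_(i < n) x ord0 i ^+ 2).

Definition C_lLip (R : realType) (n : nat) (phi : 'rV[R]_n -> R) : Prop :=
  exists (C : R) (m : nat), 0 < C /\
    forall x y : 'rV[R]_n,
      `|phi x - phi y| <=
        C * (1 + eucl_norm x ^+ m + eucl_norm y ^+ m) * eucl_norm (x - y).

Section SublinearExpectation.
Context {R : realType} {Omega : Type}.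
Implicit Types (H G : set (Omega -> R)) (E : (Omega -> R) -> \bar R).

Definition linear_space H : Prop :=
  H (cst 0) /\
  forall (a : R) (X Y : Omega -> R), H X -> H Y -> H (fun w => a * X w + Y w).

Definition C_lLip_stable H : Prop :=
  forall (n : nat) (phi : 'rV[R]_n -> R) (X : 'I_n -> Omega -> R),
    C_lLip phi -> (forall i, H (X i)) -> H (fun w => phi (\row_i X i w)).

(* The expectation is a map on all functions, but it is constrained, and later
   evaluated, only on H; its values outside H carry no meaning. *)
Record sublinear_expectation_space H E : Prop := {
  sle_linear : linear_space H ;
  sle_stable : C_lLip_stable H ;
  sle_monotone : forall X Y, H X -> H Y ->
    (forall w, Y w <= X w) -> (E Y <= E X)%E ;
  sle_cst : forall c : R, E (cst c) = c%:E ;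
  sle_subadditive : forall X Y, H X -> H Y ->
    adde_def (E X) (E Y) -> (E (X \+ Y)%R <= E X + E Y)%E ;
  sle_homogeneous : forall (a : R) X, H X -> 0 <= a ->
    E (fun w => a * X w) = (a%:E * E X)%E
}.

(* The formula makes sense for every set A, measurable or not. *)
Definition capacity H E (A : set Omega) : \bar R :=
  ereal_inf [set E xi | xi in [set xi | H xi /\ forall w, \1_A w <= xi w]].

Definition integrable_part H E : set (Omega -> R) :=
  [set X | H X /\ (E (fun w => `|X w|%R) < +oo)%E].

Definition le_L1 E (X Y : Omega -> R) : Prop := E ((X \- Y)^\+) = 0%E.

Definition eq_L1 E (X Y : Omega -> R) : Prop := le_L1 E X Y /\ le_L1 E Y X.

Record rv_subspace H G : Prop := {
  rvs_sub : G `<=` H ;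
  rvs_linear : linear_space G ;
  rvs_cst : forall c : R, G (cst c) ;
  rvs_stable : C_lLip_stable G
}.

Record cond_expectation H E G (EG : (Omega -> R) -> Omega -> R) : Prop := {
  ce_range : forall X, integrable_part H E X -> integrable_part G E (EG X) ;
  ce_translation : forall X Y,
    integrable_part H E X -> integrable_part H E Y -> G X ->
    eq_L1 E (EG (X \+ Y)) (X \+ EG Y) ;
  ce_pullout : forall X Y,
    integrable_part H E X -> integrable_part H E Y -> G X ->
    integrable_part H E (X \* Y) ->
    eq_L1 E (EG (X \* Y)) ((X^\+ \* EG Y) \+ (X^\- \* EG (\- Y))) ;
  ce_tower : forall X, integrable_part H E X -> E (EG X) = E X
}.

End SublinearExpectation.

(* Main.v *)
(* With [t = ln (1 + x y / A) / y] and
   [g = (exp (t y) - 1 - t y) / y^2] one has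
   [exp (t min(z, y)) <= 1 + t z + g z^2], so the products of
   [exp (t min(Z_k, y) - g E[Z_k^2 | H_(k-1)]^+)] form a supermartingale started
   at [1]. Indicators are not available in the space of random variables, so
   instead of stopping it when the sum of the [Z_k] reaches [x] one stops it
   gradually while that sum runs through [x - d, x]. Outside the exceptional
   event, and where no conditional variance is below [- d / k_n] (which fails
   only on a set covered by a variable of zero expectation), the stopped value
   is at least [exp (t (x - d) - g (A + d))] as soon as the sum reaches [x].
   Letting [d] tend to [0] gives the bound [exp (- t x + g A)], and the form in
   the theorem follows from [ln (1 + u) >= u (6 + 9 u) / (6 + 12 u + 4 u^2)]. *)

Require Import Defs.
From HB Require Import structures.
From mathcomp Require Import all_boot all_order all_algebra.
From mathcomp Require Import all_classical all_reals all_analysis.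
From mathcomp Require Import ring lra.

Set Implicit Arguments.
Unset Strict Implicit.
Unset Printing Implicit Defensive.

Import Order.TTheory GRing.Theory Num.Theory.

Local Open Scope classical_set_scope.
Local Open Scope ring_scope.

(** * Bounds for the exponential and the logarithm *)

Lemma is_derive_ge0_le (R : realType) (f df : R -> R) (a b : R) : a <= b ->
  (forall z, a <= z <= b -> is_derive z 1 f (df z)) ->
  (forall z, a <= z <= b -> 0 <= df z) -> f a <= f b.
Proof.
move=> ab fdf df0.
have [z|c|c zab] := @MVT_segment R f df a b ab; rewrite ?in_itv /=.
- by move=> /andP[az zb]; apply: fdf; rewrite !ltW.
- apply: derivable_within_continuous => z; rewrite in_itv /= => zab.
  by have [] := fdf z zab.
- by rewrite -subr_ge0 => ->; rewrite mulr_ge0 ?df0 ?subr_ge0.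
Qed.

Lemma expR_le_taylor2 (R : realType) (s : R) : s <= 0 ->
  expR s <= 1 + s + s ^+ 2 / 2.
Proof.
move=> s0; rewrite -subr_ge0 -oppr_le0.
pose f (z : R) := - (1 + z + z ^+ 2 / 2 - expR z).
have := @is_derive_ge0_le R f (fun z => expR z - (1 + z)) s 0 s0.
rewrite /f expR0 expr0n /= mul0r !addr0 subrr oppr0; apply.
- move=> z _; rewrite /f; apply: is_derive_eq; rewrite /GRing.scale/=; lra.
- by move=> z _; rewrite subr_ge0 expR_ge1Dx.
Qed.

Lemma expR_ge_taylor2 (R : realType) (s : R) : 0 <= s ->
  1 + s + s ^+ 2 / 2 <= expR s.
Proof.
move=> s0; rewrite -subr_ge0.
pose f (z : R) := expR z - (1 + z + z ^+ 2 / 2).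
have := @is_derive_ge0_le R f (fun z => expR z - (1 + z)) 0 s s0.
rewrite /f expR0 expr0n /= mul0r !addr0 subrr; apply.
- move=> z _; rewrite /f; apply: is_derive_eq; rewrite /GRing.scale/=; lra.
- by move=> z _; rewrite subr_ge0 expR_ge1Dx.
Qed.

(** This is the numerator of the derivative of [(expR z - 1 - z) / z ^+ 2]. It vanishes at [0], and
    its own derivative [expR z * (z - 1) + 1] is nonnegative because [1 - z <= expR (- z)]. *)
Lemma mul_expR_ge0 (R : realType) (s : R) : 0 <= s ->
  0 <= expR s * (s - 2) + s + 2.
Proof.
move=> s0.
pose f (z : R) := expR z * (z - 2) + z + 2.
have := @is_derive_ge0_le R f (fun z => expR z * (z - 1) + 1) 0 s s0.
have -> : f 0 = 0 by rewrite /f expR0; lra.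
apply.
- move=> z _; rewrite /f; apply: is_derive_eq; rewrite /GRing.scale/=; lra.
- move=> z _; have e0 := expR_gt0 z.
  have := expR_ge1Dx (- z); rewrite -(ler_pM2l e0) expRN divff ?gt_eqF//.
  lra.
Qed.

Lemma expR_rem2_le (R : realType) (a b : R) : 0 < a -> a <= b ->
  (expR a - 1 - a) / a ^+ 2 <= (expR b - 1 - b) / b ^+ 2.
Proof.
move=> a0 ab.
apply: (@is_derive_ge0_le R (fun z => (expR z - 1 - z) / z ^+ 2)
  (fun z => (expR z * (z - 2) + z + 2) / z ^+ 3)) => // z /andP[az _];
  have z0 : 0 < z by exact: lt_le_trans az.
- have zn0 : z != 0 by rewrite gt_eqF.
  have z2 : z ^+ 2 != 0 by rewrite expf_neq0.
  apply: is_derive_eq.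
  by rewrite /GRing.scale/=; field.
- by rewrite divr_ge0 ?exprn_ge0 ?mul_expR_ge0// ltW.
Qed.

(** The coefficient [g] makes this an equality at [z = y]. Above [y] the left side is constant and
    the right side increases. On []0, y]] the second-order remainder quotient is monotone. For
    [z <= 0] the quadratic Taylor bound suffices, since [t ^+ 2 / 2 <= g]. *)
Lemma expR_minr_le (R : realType) (t y z : R) : 0 < t -> 0 < y ->
  expR (t * Num.min z y) <=
    1 + t * z + (expR (t * y) - 1 - t * y) / y ^+ 2 * z ^+ 2.
Proof.
move=> t0 y0; set g := _ / _.
have ty0 : 0 < t * y by rewrite mulr_gt0.
have y2 : 0 < y ^+ 2 by rewrite exprn_gt0.
have gy : g * y ^+ 2 = expR (t * y) - 1 - t * y.
  by rewrite /g divfK// gt_eqF.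
have gt2 : t ^+ 2 / 2 <= g.
  have := expR_ge_taylor2 (ltW ty0); rewrite exprMn => h.
  rewrite -(ler_pM2r y2) gy; lra.
have g0 : 0 <= g by apply: le_trans gt2; rewrite divr_ge0// sqr_ge0.
have [zy|yz] := leP z y; last first.
  have -> : expR (t * y) = 1 + t * y + g * y ^+ 2 by rewrite gy; lra.
  apply: lerD; first by rewrite lerD2l ler_pM2l// ltW.
  by rewrite ler_wpM2l// ler_sqr ?nnegrE ?ltW// (lt_trans y0).
have [z0|z0] := leP z 0.
  have tz0 : t * z <= 0 by rewrite pmulr_rle0.
  apply: le_trans (expR_le_taylor2 tz0) _.
  by rewrite lerD2l exprMn mulrAC ler_wpM2r ?sqr_ge0.
have tz0 : 0 < t * z by rewrite mulr_gt0.
have tzy : t * z <= t * y by rewrite ler_pM2l.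
have := expR_rem2_le tz0 tzy; rewrite ler_pdivrMr ?exprn_gt0//.
have -> : (expR (t * y) - 1 - t * y) / (t * y) ^+ 2 * (t * z) ^+ 2 = g * z ^+ 2.
  by rewrite /g; field; rewrite !gt_eqF.
lra.
Qed.

(** The difference vanishes at [0] and its derivative is a quotient with nonnegative coefficients.
    This rational minorant is exactly what the comparison of exponents in [bennett_exponent_le]
    reduces to. *)
Lemma ln1D_ge (R : realType) (u : R) : 0 <= u ->
  u * (6 + 9 * u) / (6 + 12 * u + 4 * u ^+ 2) <= ln (1 + u).
Proof.
move=> u0; rewrite -subr_ge0.
pose D (z : R) := 6 + 12 * z + 4 * z ^+ 2.
pose f (z : R) := ln (1 + z) - z * (6 + 9 * z) / D z.
have := @is_derive_ge0_le R f
  (fun z => (12 * z ^+ 3 + 16 * z ^+ 4) / ((1 + z) * D z ^+ 2)) 0 u u0.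
have -> : f 0 = 0 by rewrite /f addr0 ln1 !mul0r subr0.
apply => z /andP[z0 _].
- have D0 : D z != 0 by rewrite /D gt_eqF//; nra.
  have z1 : 1 + z != 0 by rewrite gt_eqF//; lra.
  rewrite /f.
  have z1' : 0 < 1 + z by lra.
  have h1 := is_derive1_ln z1'.
  have h2 : is_derive z (1 : R) (fun z => 1 + z) 1.
    by apply: is_derive_eq; lra.
  have h3 := is_derive1_comp h1 h2.
  have h4 : is_derive z 1 D (12 + 8 * z).
    by rewrite /D; apply: is_derive_eq; rewrite /GRing.scale/=; lra.
  have h5 := is_deriveV D0 h4.
  apply: is_derive_eq.
  rewrite /GRing.scale/=; move: D0; rewrite /D => D0; field.
  by rewrite z1 D0.
- rewrite divr_ge0 ?addr_ge0 ?mulr_ge0 ?exprn_ge0 ?addr_ge0 ?mulr_ge0 ?exprn_ge0//.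
Qed.

(** The given [t] minimises the left side: there [expR (t * y) = 1 + u] with [u = x * y / A]. After
    this substitution the two sides differ by a positive multiple of [ln (1 + u) * (6 + 12 * u + 4 *
    u ^+ 2) - u * (6 + 9 * u)]. *)
Lemma bennett_exponent_le (R : realType) (x y A t : R) :
  0 < x -> 0 < y -> 0 < A -> t = ln (1 + x * y / A) / y ->
  - (t * x) + (expR (t * y) - 1 - t * y) / y ^+ 2 * A <=
    - (x ^+ 2 / (2 * (x * y + A)) * (1 + 2 / 3 * ln (1 + x * y / A))).
Proof.
move=> x0 y0 A0 ->.
have yn : y != 0 by rewrite gt_eqF.
have An : A != 0 by rewrite gt_eqF.
have u0 : 0 < x * y / A by rewrite divr_gt0// mulr_gt0.
rewrite divfK// lnK; last by rewrite posrE addr_gt0.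
have := ln1D_ge (ltW u0).
have xE : x = x * y / A * A / y by field; rewrite yn An.
set L := ln _; set u := x * y / A in u0 xE *.
rewrite ler_pdivrMr; last by move: u0; nra.
move=> hL; rewrite -subr_ge0.
have u1 : 1 + u != 0 by rewrite gt_eqF// addr_gt0.
rewrite [in X in 0 <= X]xE.
have -> : - (((u * A / y) ^+ 2 / (2 * (u * A / y * y + A))) * (1 + 2 / 3 * L)) -
    (- (L / y * (u * A / y)) + (1 + u - 1 - L) / y ^+ 2 * A) =
  A / y ^+ 2 / (6 * (1 + u)) * (L * (6 + 12 * u + 4 * u ^+ 2) - u * (6 + 9 * u)).
  field; rewrite yn u1 /=.
  by rewrite (_ : _ + _ = A * (1 + u)) ?mulf_neq0//; ring.
rewrite mulr_ge0 ?subr_ge0// !divr_ge0 ?mulr_ge0 ?exprn_ge0 ?addr_ge0 ?ltW//.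
Qed.

(** * Random variables and sub-linear expectations *)

Lemma normr_le_eucl_norm (R : realType) (n : nat) (v : 'rV[R]_n) (i : 'I_n) :
  `|v ord0 i| <= eucl_norm v.
Proof.
rewrite /eucl_norm -sqrtr_sqr ler_sqrt ?sumr_ge0//; last first.
  by move=> j _; rewrite sqr_ge0.
by rewrite (bigD1 i)//= lerDl sumr_ge0// => j _; rewrite sqr_ge0.
Qed.

Lemma ler_dist_maxr (R : realDomainType) (a b c : R) :
  `|Num.max a c - Num.max b c| <= `|a - b|.
Proof.
have [ac|ac] := leP a c; have [bc|bc] := leP b c; rewrite ler_norml;
  have := ler_norm (a - b); have := ler_norm (b - a); rewrite distrC;
  move: (`|_|) => k; lra.
Qed.

Lemma ler_dist_minr (R : realDomainType) (a b c : R) :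
  `|Num.min a c - Num.min b c| <= `|a - b|.
Proof.
have [ac|ac] := leP a c; have [bc|bc] := leP b c; rewrite ler_norml;
  have := ler_norm (a - b); have := ler_norm (b - a); rewrite distrC;
  move: (`|_|) => k; lra.
Qed.

Section RandomVariables.
Context {R : realType} {Omega : Type}.
Implicit Types (X Y : Omega -> R) (H G : set (Omega -> R)).

(** * Closure of spaces of random variables under elementary operations *)

Section Closure.
Context {H G : set (Omega -> R)} (hG : rv_subspace H G).

Lemma rvs_comp (f : R -> R) (K : R) X :
  (forall a b, `|f a - f b| <= K * `|a - b|) -> G X -> G (fun w => f (X w)).
Proof.
move=> fK GX.
pose phi (v : 'rV[R]_1) := f (v ord0 ord0).
have -> : (fun w => f (X w)) = (fun w => phi (\row_(i < 1) X w)).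
  by apply/funext => w; rewrite /phi mxE.
apply: (rvs_stable hG (n := 1) (phi := phi) (X := fun=> X)) => //; rewrite /phi.
(* A positive constant is demanded while the sign of [K] is free, hence [|K| + 1]; with exponent [0]
   the growth weight is the constant [3]. *)
exists (`|K| + 1), 0%N; split; first by rewrite ltr_wpDl.
move=> u v; rewrite !expr0; apply: le_trans (fK _ _) _.
have := normr_le_eucl_norm (u - v) ord0; rewrite !mxE => h.
have h0 : 0 <= eucl_norm (u - v) by rewrite sqrtr_ge0.
apply: (le_trans (y := `|K| * eucl_norm (u - v))).
  by apply: le_trans (ler_wpM2r _ (ler_norm K)) _; rewrite ?ler_wpM2l.
rewrite ler_wpM2r//; have := normr_ge0 K; lra.
Qed.

(** The product on the plane is not Lipschitz, but [a * b - c * d = a * (b - d) + d * (a - c)]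
    bounds its increments with linear growth, that is with exponent [1] in [C_lLip]. *)
Lemma rvs_mul X Y : G X -> G Y -> G (fun w => X w * Y w).
Proof.
move=> GX GY.
pose F (i : 'I_2) := if i == ord0 then X else Y.
pose phi (v : 'rV[R]_2) := v ord0 ord0 * v ord0 ord_max.
have -> : (fun w => X w * Y w) = (fun w => phi (\row_i F i w)).
  by apply/funext => w; rewrite /phi !mxE.
apply: (rvs_stable hG (n := 2) (phi := phi) (X := F)); last by move=> i; rewrite /F; case: ifP.
rewrite /phi.
exists 1, 1%N; split => // u v; rewrite !expr1 mul1r.
have h1 := normr_le_eucl_norm (u - v) ord0.
have h2 := normr_le_eucl_norm (u - v) ord_max.
have h3 := normr_le_eucl_norm u ord0.
have h4 := normr_le_eucl_norm v ord_max.
rewrite !mxE in h1 h2.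
set a := u _ _ in h1 h3 *; set b := u _ _ in h2 *.
set c := v _ _ in h1 *; set d := v _ _ in h2 h4 *.
have -> : a * b - c * d = a * (b - d) + d * (a - c) by ring.
apply: le_trans (ler_normD _ _) _; rewrite !normrM.
have h0 : 0 <= eucl_norm (u - v) by rewrite sqrtr_ge0.
apply: (le_trans (y := eucl_norm u * eucl_norm (u - v) +
                       eucl_norm v * eucl_norm (u - v))).
  by apply: lerD; apply: ler_pM.
by rewrite -mulrDl ler_wpM2r// -addrA lerDr.
Qed.

Lemma rvs_lin (a : R) X Y : G X -> G Y -> G (fun w => a * X w + Y w).
Proof. by move=> GX GY; apply: (rvs_linear hG).2. Qed.

Lemma rvs_scale (a : R) X : G X -> G (fun w => a * X w).
Proof.
move=> GX; have := rvs_lin a GX (rvs_cst hG 0).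
by congr G; apply/funext => w; rewrite /= addr0.
Qed.

Lemma rvs_opp X : G X -> G (fun w => - X w).
Proof.
by move=> /(rvs_scale (-1)); congr G; apply/funext => w; rewrite mulN1r.
Qed.

Lemma rvs_add X Y : G X -> G Y -> G (fun w => X w + Y w).
Proof.
move=> GX GY; have := rvs_lin 1 GX GY.
by congr G; apply/funext => w; rewrite mul1r.
Qed.

Lemma rvs_diff X Y : G X -> G Y -> G (fun w => X w - Y w).
Proof. by move=> GX GY; apply: rvs_add => //; apply: rvs_opp. Qed.

Lemma rvs_abs X : G X -> G (fun w => `|X w|).
Proof.
by apply: (@rvs_comp (fun z => `|z|) 1) => a b; rewrite mul1r ler_dist_dist.
Qed.

Lemma rvs_maxr (c : R) X : G X -> G (fun w => Num.max (X w) c).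
Proof.
by apply: (@rvs_comp (Num.max^~ c) 1) => a b; rewrite mul1r ler_dist_maxr.
Qed.

Lemma rvs_minr (c : R) X : G X -> G (fun w => Num.min (X w) c).
Proof.
by apply: (@rvs_comp (Num.min^~ c) 1) => a b; rewrite mul1r ler_dist_minr.
Qed.

Lemma rvs_sum (F : nat -> Omega -> R) (m n : nat) :
  (forall i, (m <= i < n)%N -> G (F i)) ->
  G (fun w => \sum_(m <= i < n) F i w).
Proof.
elim: n => [|n IH] GF.
  have := rvs_cst hG 0; congr G; apply/funext => w.
  by rewrite big_geq.
have [mn|nm] := leqP m n; last first.
  have := rvs_cst hG 0; congr G; apply/funext => w.
  by rewrite big_geq.
have -> : (fun w => \sum_(m <= i < n.+1) F i w) =
          (fun w => \sum_(m <= i < n) F i w + F n w).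
  by apply/funext => w; rewrite big_nat_recr.
apply: rvs_add; last by apply: GF; rewrite mn ltnSn.
by apply: IH => i /andP[mi i_n]; apply: GF; rewrite mi ltnW.
Qed.

(* [expR] is not Lipschitz, hence the upper bound [M] on the exponent. *)
Lemma rvs_expR (M : R) X : G X -> (forall w, X w <= M) -> G (fun w => expR (X w)).
Proof.
move=> GX XM.
have -> : (fun w => expR (X w)) = (fun w => expR (Num.min (X w) M)).
  by apply/funext => w; rewrite min_l.
apply: (@rvs_comp (fun z => expR (Num.min z M)) (expR M)) => // a b.
have key u v : u <= v -> v <= M -> `|expR u - expR v| <= expR M * `|u - v|.
  move=> uv vM; rewrite distrC (distrC u) !ger0_norm ?subr_ge0 ?ler_expR//.
  apply: (le_trans (y := expR v * (v - u))); last first.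
    by rewrite ler_wpM2r ?subr_ge0// ler_expR.
  (* The tangent of [expR] at [v] lies below its graph at [u], which gives the slope bound
     [expR v]. *)
  have := expR_ge1Dx (u - v).
  rewrite -(ler_pM2l (expR_gt0 v)) -expRD (_ : v + (u - v) = u); last by ring.
  lra.
apply: (le_trans (y := expR M * `|Num.min a M - Num.min b M|)); last first.
  by rewrite ler_wpM2l ?expR_ge0 ?ler_dist_minr.
have aM : Num.min a M <= M by rewrite ge_min lexx orbT.
have bM : Num.min b M <= M by rewrite ge_min lexx orbT.
have [h|h] := orP (le_total (Num.min a M) (Num.min b M)); first exact: key.
by rewrite distrC (distrC (Num.min a M)) key.
Qed.

End Closure.

(** * Consequences of the axioms of a sub-linear expectation *)

Section Expectation.
Context {H : set (Omega -> R)} {E : (Omega -> R) -> \bar R}.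
Context (hE : sublinear_expectation_space H E).

(** This makes the closure lemmas available for [H] itself. Constants are obtained by applying a
    constant function to the zero variable. *)
Lemma sle_rv_subspace : rv_subspace H H.
Proof.
split => //; [exact: sle_linear hE| |exact: sle_stable hE] => c.
have [H0 _] := sle_linear hE.
apply: (sle_stable hE (n := 1) (phi := fun=> c) (X := fun=> cst 0)) => //.
exists 1, 0%N; split => // u v; rewrite subrr normr0 mulr_ge0 ?sqrtr_ge0//.
by rewrite !expr0; lra.
Qed.
Let hH := sle_rv_subspace.

Lemma sle_ge0 X : H X -> (forall w, 0 <= X w) -> (0 <= E X)%E.
Proof.
move=> HX X0; have <- : E (cst 0) = 0%E := sle_cst hE 0.
by apply: (sle_monotone hE) => //; apply: (rvs_cst hH).
Qed.

(** The real bound [a] excludes [E X = +oo]. If [E Y = +oo] then [b = +oo] and the claim is trivial;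
    otherwise no indeterminate sum occurs and subadditivity applies. *)
Lemma sle_add_le (a : R) (b : \bar R) X Y : H X -> H Y ->
  (E X <= a%:E)%E -> (E Y <= b)%E -> (E (fun w => X w + Y w)%R <= a%:E + b)%E.
Proof.
move=> HX HY EXa EYb.
have [EY|EY] := eqVneq (E Y) +oo%E.
  by move: EYb; rewrite EY leye_eq => /eqP ->; rewrite addey// leey.
apply: le_trans (leeD EXa EYb).
apply: (sle_subadditive hE) => //; rewrite /adde_def.
case: (E X) EXa (E Y) EY => [r| |] // _ [s| |] //.
Qed.

(** Pointwise [X] is at most the positive part of [X - Y], of zero expectation, plus [Y]. *)
Lemma sle_le_L1 X Y : H X -> H Y -> le_L1 E X Y -> (E X <= E Y)%E.
Proof.
move=> HX HY XY; rewrite -[leRHS]add0e.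
have HP : H (fun w => Num.max (X w - Y w) 0).
  by apply: (rvs_maxr hH); apply: (rvs_diff hH).
apply: le_trans (sle_add_le (a := 0) HP HY _ (lexx _)).
  apply: (sle_monotone hE) => //; first exact: (rvs_add hH).
  by move=> w; rewrite -lerBlDr le_max lexx.
by have -> : E (fun w => Num.max (X w - Y w) 0) = 0%E := XY.
Qed.

Lemma sle_eq_L1 X Y : H X -> H Y -> eq_L1 E X Y -> E X = E Y.
Proof.
by move=> HX HY [XY YX]; apply/eqP; rewrite eq_le !sle_le_L1.
Qed.

Lemma integrable_part_dom X Y : H X -> H Y -> (forall w, `|X w| <= Y w) ->
  (E Y < +oo)%E -> integrable_part H E X.
Proof.
move=> HX HY XY EY; split => //; apply: le_lt_trans EY.
by apply: (sle_monotone hE) => //; apply: (rvs_abs hH).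
Qed.

Lemma integrable_part_bounded (c : R) X : H X -> (forall w, `|X w| <= c) ->
  integrable_part H E X.
Proof.
move=> HX Xc; apply: (integrable_part_dom HX (rvs_cst hH c)) => //.
by rewrite (sle_cst hE) ltry.
Qed.

Lemma integrable_part_bound X : integrable_part H E X ->
  exists2 a : R, (E (fun w => `|X w|)%R <= a%:E)%E & 0 <= a.
Proof.
move=> [HX]; have := @sle_ge0 (fun w => `|X w|) (rvs_abs hH HX) (fun=> normr_ge0 _).
by case: (E _) => // a; exists a.
Qed.

Lemma integrable_part_scale (c : R) X : integrable_part H E X ->
  integrable_part H E (fun w => c * X w).
Proof.
move=> hX; have [a Ea a0] := integrable_part_bound hX; case: hX => HX _.
apply: (integrable_part_dom (Y := fun w => `|c| * `|X w|)).
- exact: (rvs_scale hH).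
- by apply: (rvs_scale hH); apply: (rvs_abs hH).
- by move=> w; rewrite normrM.
- rewrite (sle_homogeneous hE) ?normr_ge0//; last exact: (rvs_abs hH).
  by apply: (@le_lt_trans _ _ (`|c| * a)%:E); rewrite ?ltry// EFinM lee_wpmul2l.
Qed.

Lemma integrable_part_add X Y : integrable_part H E X -> integrable_part H E Y ->
  integrable_part H E (fun w => X w + Y w).
Proof.
move=> hX hY; have [a Ea a0] := integrable_part_bound hX.
have [b Eb b0] := integrable_part_bound hY; case: hX hY => HX _ [HY _].
apply: (integrable_part_dom (Y := fun w => `|X w| + `|Y w|)).
- exact: (rvs_add hH).
- by apply: (rvs_add hH); apply: (rvs_abs hH).
- by move=> w; rewrite ler_normD.
- apply: le_lt_trans (sle_add_le _ _ Ea Eb) _; try exact: (rvs_abs hH).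
  by rewrite -EFinD ltry.
Qed.

Lemma integrable_part_bmul (c : R) D X : H D -> (forall w, `|D w| <= c) ->
  integrable_part H E X -> integrable_part H E (fun w => D w * X w).
Proof.
move=> HD Dc hX; have [HX _] := hX.
have [HcX cX] := integrable_part_scale c hX.
apply: (integrable_part_dom (Y := fun w => `|c * X w|)) => //.
- exact: (rvs_mul hH).
- exact: (rvs_abs hH).
- move=> w; rewrite !normrM ler_wpM2r//; apply: le_trans (Dc w) _.
  exact: ler_norm.
Qed.

End Expectation.
End RandomVariables.

(** * Conditional expectations *)

Section ConditionalExpectation.
Context {R : realType} {Omega : Type}.
Context {H G : set (Omega -> R)}.
Context {E : (Omega -> R) -> \bar R} {EG : (Omega -> R) -> Omega -> R}.
Context (hE : sublinear_expectation_space H E) (hG : rv_subspace H G).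
Context (hEG : cond_expectation H E G EG).
Let hH := sle_rv_subspace hE.

(** The tower property introduces [EG], after which [X] is translated out and [D] is pulled out. The
    bound on [D] makes [D * U] integrable, and [0 <= D] removes the term with [EG (- U)]. *)
Lemma cond_expectation_pullout (c : R) (X D U : Omega -> R) :
  G X -> integrable_part H E X -> G D -> (forall w, 0 <= D w <= c) ->
  integrable_part H E U ->
  E (fun w => X w + D w * U w) = E (fun w => X w + D w * EG U w).
Proof.
move=> GX IX GD D0c IU.
have HD : H D by exact: (rvs_sub hG).
have Dc w : `|D w| <= c by have /andP[D0 ?] := D0c w; rewrite ger0_norm.
have IDU := integrable_part_bmul hE HD Dc IU.
have IXDU := integrable_part_add hE IX IDU.
have Hsub Y : G Y -> H Y by exact: (rvs_sub hG).
have [GEU _] := ce_range hEG IU.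
have [GEDU _] := ce_range hEG IDU.
have [GEXDU _] := ce_range hEG IXDU.
rewrite -(ce_tower hEG IXDU).
rewrite (sle_eq_L1 hE _ _ (ce_translation hEG IX IDU GX)); last 2 first.
- exact: Hsub.
- by apply: Hsub; apply: (rvs_add hG).
have HXDEU : H (fun w => X w + D w * EG U w).
  by apply: Hsub; apply: (rvs_add hG) => //; apply: (rvs_mul hG).
apply: (sle_eq_L1 hE) => //; first by apply: Hsub; apply: (rvs_add hG).
have [] := ce_pullout hEG (conj HD (integrable_part_bounded hE HD Dc).2) IU GD IDU.
have -> : (D^\+ \* EG U) \+ (D^\- \* EG (\- U)) = (fun w => D w * EG U w).
  apply/funext => w /=; have /andP[D0 _] := D0c w.
  by rewrite /funrpos /funrneg /= max_l// max_r ?oppr_le0// mul0r addr0.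
(* The common summand [X] cancels in both differences, so the pull-out equality is all that is
   needed. *)
rewrite /eq_L1 /le_L1 => h1 h2.
by split; [rewrite -[RHS]h1|rewrite -[RHS]h2]; congr E; apply/funext => w;
  rewrite /funrpos /= (_ : (D \* U) = (fun w => D w * U w))//;
  congr Num.max; ring.
Qed.

(* [EG] is not assumed monotone: positivity is obtained by pulling out the
   weight [f], a bounded Lipschitz approximation of the indicator of [EG U < 0]. *)
Lemma cond_expectation_ge0 (U : Omega -> R) : integrable_part H E U ->
  (forall w, 0 <= U w) -> E (fun w => Num.max (- EG U w) 0) = 0%E.
Proof.
move=> IU U0; have [GV _] := ce_range hEG IU.
set V := EG U in GV *; pose N w := Num.max (- V w) 0.
have GN : G N by apply: (rvs_maxr hG); apply: (rvs_opp hG).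
have Hsub Y : G Y -> H Y by exact: (rvs_sub hG).
have N0 w : 0 <= N w by rewrite le_max lexx orbT.
apply/eqP; rewrite eq_le; apply/andP; split; last by apply: (sle_ge0 hE) => //; exact: Hsub.
apply/lee_addgt0Pr => e e0; rewrite add0e.
pose f w := Num.min (e^-1 * N w) 1.
have Gf : G f by apply: (rvs_minr hG); apply: (rvs_scale hG).
have f01 w : 0 <= f w <= 1.
  by rewrite le_min ler01 ge_min lexx orbT mulr_ge0 ?invr_ge0 ?(ltW e0).
have GfN : G (fun w => f w * N w) by apply: (rvs_mul hG).
have fN w : f w * V w = - (f w * N w).
  have [V0|V0] := leP 0 (V w).
    have -> : f w = 0.
      by rewrite /f /N max_r ?oppr_le0// mulr0 min_l.
    by rewrite !mul0r oppr0.
  by rewrite /N max_l ?oppr_ge0 ?ltW// mulrN opprK.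
have IV : integrable_part H E V.
  by have [_ ?] := ce_range hEG IU; split => //; exact: Hsub.
have nf w : `|f w| <= 1 by have /andP[? ?] := f01 w; rewrite ger0_norm.
have IfV := integrable_part_scale hE (-1) (integrable_part_bmul hE (Hsub _ Gf) nf IV).
have GfV : G (fun w => -1 * (f w * V w)).
  by apply: (rvs_scale hG); apply: (rvs_mul hG).
(* Pulling out [f] replaces [U] by [V], and the two terms cancel. *)
have E0 : E (fun w => -1 * (f w * V w) + f w * U w) = 0%E.
  rewrite (cond_expectation_pullout GfV IfV Gf f01 IU) -/V.
  rewrite -[RHS](sle_cst hE 0); congr E; apply/funext => w /=; ring.
have HW : H (fun w => -1 * (f w * V w) + f w * U w).
  apply: (rvs_add hH); first exact: Hsub.
  by apply: (rvs_mul hH); [exact: Hsub|exact: IU.1].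
have Ee : (E (cst e) <= e%:E)%E by rewrite (sle_cst hE).
have := sle_add_le hE (rvs_cst hH e) HW Ee (lexx _); rewrite E0 adde0.
apply: le_trans; apply: (sle_monotone hE).
- exact: (rvs_add hH (rvs_cst hH e)).
- exact: Hsub.
move=> w /=; rewrite mulN1r fN opprK.
have fU : 0 <= f w * U w by rewrite mulr_ge0//; have /andP[] := f01 w.
(* Where [e <= N w] the weight [f w] equals [1]; elsewhere [N w] is below [e]. *)
rewrite -/(N w); suff : N w <= e + f w * N w by lra.
have [h|h] := leP 1 (e^-1 * N w).
  by rewrite /f min_r// mul1r lerDr ltW.
have Ne : N w < e by rewrite -(mulr1 e) -ltr_pdivrMl.
by apply: (le_trans (ltW Ne)); rewrite lerDl mulr_ge0//; have /andP[] := f01 w.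
Qed.

(** The truncated variable equals [1] wherever [e <= N w], so it covers that set at no cost in
    expectation. *)
Lemma expectation_min_eq0 (e : R) (N : Omega -> R) : 0 < e -> H N ->
  (forall w, 0 <= N w) -> E N = 0%E ->
  (E (fun w => Num.min (e^-1 * N w) 1)%R <= 0)%E.
Proof.
move=> e0 HN N0 EN.
have e'0 : 0 <= e^-1 by rewrite invr_ge0 ltW.
apply: (@le_trans _ _ (E (fun w => e^-1 * N w)%R)); last first.
  by rewrite (sle_homogeneous hE)// EN mule0.
apply: (sle_monotone hE); first exact: (rvs_scale hH).
- by apply: (rvs_minr hH); exact: (rvs_scale hH).
- by move=> w; rewrite ge_min lexx.
Qed.

(** Integrability of [Z] comes from the domination of its absolute value by [Z ^+ 2 + 1]. *)
Lemma integrable_part_sqr (Z : Omega -> R) : H Z ->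
  (E (fun w => (Z w ^+ 2)%R) < +oo)%E ->
  integrable_part H E Z /\ integrable_part H E (fun w => Z w ^+ 2).
Proof.
move=> HZ EZ2.
have HZ2 : H (fun w => Z w ^+ 2) by exact: (rvs_mul hH).
have IZ2 : integrable_part H E (fun w => Z w ^+ 2).
  by apply: (integrable_part_dom hE HZ2 HZ2) => // w; rewrite ger0_norm ?sqr_ge0.
split => //.
have I1 : integrable_part H E (cst 1).
  apply: (integrable_part_bounded hE (c := 1) (rvs_cst hH 1)) => w.
  by rewrite normr1.
have [_ IY] := integrable_part_add hE IZ2 I1.
apply: (integrable_part_dom hE HZ _ _ IY).
  by apply: (rvs_abs hH); apply: (rvs_add hH) => //; exact: (rvs_cst hH).
move=> w /=; apply: le_trans (ler_norm _).
have := sqr_ge0 (`|Z w| - 1); rewrite sqrrB real_normK ?num_real//.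
have := sqr_ge0 (Z w); have := normr_ge0 (Z w); rewrite mulr1 expr1n; lra.
Qed.

(* Conditional subadditivity is not available, so the second-order bound of
   [expR] is split into three terms and subadditivity of [E] is used instead. *)
Lemma supermartingale_step (t y c : R) (C D Z : Omega -> R) :
  let g := (expR (t * y) - 1 - t * y) / y ^+ 2 in
  let V := EG (fun w => Z w ^+ 2) in
  0 < t -> 0 < y ->
  H Z -> (E (fun w => (Z w ^+ 2)%R) < +oo)%E -> le_L1 E (EG Z) (cst 0) ->
  G C -> integrable_part H E C -> G D -> (forall w, 0 <= D w <= c) ->
  (E (fun w => (C w + D w * (expR (t * Num.min (Z w) y) *
                              expR (- (g * Num.max (V w) 0))))%R)
   <= E (fun w => (C w + D w)%R))%E.
Proof.
move=> g V t0 y0 HZ EZ2 EZ GC IC GD D0c.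
have Hsub Y : G Y -> H Y by exact: (rvs_sub hG).
have [IZ IZ2] := integrable_part_sqr HZ EZ2.
have [GV _] := ce_range hEG IZ2; have [GEZ _] := ce_range hEG IZ.
rewrite -/V in GV.
have IV : integrable_part H E V.
  by have [_ ?] := ce_range hEG IZ2; split => //; exact: Hsub.
have g0 : 0 <= g.
  rewrite divr_ge0 ?exprn_ge0 ?(ltW y0)//.
  by have := expR_ge1Dx (t * y); lra.
have D0 w : 0 <= D w by have /andP[] := D0c w.
pose W w := Num.max (V w) 0.
have W0 w : 0 <= W w by rewrite le_max lexx orbT.
have VW w : V w <= W w by rewrite le_max lexx.
have GW : G W by exact: (rvs_maxr hG).
pose F w := expR (- (g * W w)).
have GF : G F.
  apply: (rvs_expR hG (M := 0)); first by apply: (rvs_opp hG); apply: (rvs_scale hG).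
  by move=> w; rewrite oppr_le0 mulr_ge0.
have F0 w : 0 <= F w by exact: expR_ge0.
have F1 w : F w <= 1 by rewrite -expR0 ler_expR oppr_le0 mulr_ge0.
pose D' w := D w * F w.
have GD' : G D' by exact: (rvs_mul hG).
have D'0c w : 0 <= D' w <= c.
  rewrite mulr_ge0//=; have /andP[_ Dc] := D0c w; apply: le_trans Dc.
  by rewrite ler_piMr.
have D'0 w : 0 <= D' w by have /andP[] := D'0c w.
have nD' w : `|D' w| <= c by have /andP[? ?] := D'0c w; rewrite ger0_norm.
have GX2 : G (fun w => -1 * (g * (D' w * V w))).
  by do 2 apply: (rvs_scale hG); apply: (rvs_mul hG).
have IX2 : integrable_part H E (fun w => -1 * (g * (D' w * V w))).
  do 2 apply: (integrable_part_scale hE).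
  by apply: (integrable_part_bmul hE _ nD') => //; exact: Hsub.
have GX1 a : G (fun w => a * D' w) by exact: (rvs_scale hG).
have aD' a w : 0 <= a -> 0 <= a * D' w <= a * c.
  by move=> a0; have /andP[? ?] := D'0c w; rewrite mulr_ge0// ler_wpM2l.
have I0 : integrable_part H E (cst 0).
  by apply: (integrable_part_bounded hE (c := 0) (rvs_cst hH 0)) => w; rewrite normr0.
(* Second-order term: conditioning turns [Z ^+ 2] into [V], which the first summand compensates
   exactly. *)
have Evar : E (fun w => -1 * (g * (D' w * V w)) + (g * D' w) * Z w ^+ 2) = 0%E.
  rewrite (cond_expectation_pullout GX2 IX2 (GX1 g) (fun w => aD' g w g0) IZ2).
  rewrite -[RHS](sle_cst hE 0); congr E; apply/funext => w; rewrite -/V /=; ring.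
have Elin : (E (fun w => 0 + (t * D' w) * Z w)%R <= 0)%E.
  rewrite (cond_expectation_pullout (rvs_cst hG 0) I0 (GX1 t)
    (fun w => aD' t w (ltW t0)) IZ).
  have HP : H (fun w => Num.max (EG Z w - 0) 0).
    by apply: Hsub; apply: (rvs_maxr hG); apply: (rvs_diff hG) => //; exact: (rvs_cst hG).
  (* The sign of [c] is known only through a point of [Omega], which could be empty. Hence the
     quantification over [w], and the absolute value that allows homogeneity to be applied. *)
  have c0 (w : Omega) : 0 <= t * c by have /andP[h /(le_trans h)] := aD' t w (ltW t0).
  apply: (@le_trans _ _ (E (fun w => `|t * c| * Num.max (EG Z w - 0) 0)%R)).
    apply: (sle_monotone hE); first exact: (rvs_scale hH).
      apply: Hsub; apply: (rvs_add hG); first exact: (rvs_cst hG).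
      by apply: (rvs_mul hG).
    move=> w /=; rewrite add0r subr0 (ger0_norm (c0 w)).
    apply: (@le_trans _ _ (t * D' w * Num.max (EG Z w) 0)).
      by apply: ler_wpM2l; [have /andP[] := aD' t w (ltW t0)|rewrite le_max lexx].
    apply: ler_wpM2r; first by rewrite le_max lexx orbT.
    by have /andP[] := aD' t w (ltW t0).
  rewrite (sle_homogeneous hE)//.
  by have -> : E (fun w => Num.max (EG Z w - 0) 0) = 0%E := EZ; rewrite mule0.
have HC := Hsub _ GC; have HD := Hsub _ GD.
have HF := Hsub _ GF; have HD' := Hsub _ GD'.
have HV := Hsub _ GV.
have HZ2 := IZ2.1.
have H1 : H (fun w => C w + D' w + g * (D' w * V w)).
  apply: Hsub; apply: (rvs_add hG); first exact: (rvs_add hG).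
  by apply: (rvs_scale hG); exact: (rvs_mul hG).
have H2 : H (fun w => 0 + (t * D' w) * Z w).
  apply: (rvs_add hH); first exact: (rvs_cst hH).
  by apply: (rvs_mul hH) => //; exact: Hsub.
have H3 : H (fun w => -1 * (g * (D' w * V w)) + (g * D' w) * Z w ^+ 2).
  apply: (rvs_add hH); first exact: Hsub.
  by apply: (rvs_mul hH) => //; exact: Hsub.
(* The compensating factor absorbs the variance: [1 + g * V w <= expR (g * W w)], the inverse of
   [F w]. *)
have E1 : (E (fun w => C w + D' w + g * (D' w * V w))%R <= E (fun w => C w + D w)%R)%E.
  apply: (sle_monotone hE) => //; first exact: (rvs_add hH).
  move=> w; rewrite -addrA lerD2l.
  have -> : D' w + g * (D' w * V w) = D w * (F w * (1 + g * V w)).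
    by rewrite /D'; ring.
  rewrite ler_piMr// -[leRHS](mulVf (lt0r_neq0 (expR_gt0 (g * W w)))) -expRN.
  rewrite ler_wpM2l// ?expR_ge0//; apply: le_trans (expR_ge1Dx _).
  by rewrite lerD2l ler_wpM2l.
have H23 := rvs_add hH H2 H3.
have E23 := sle_add_le hE H2 H3 Elin (lexx _).
rewrite Evar add0e in E23.
(* The terms in [D' * V] cancel, so the three variables add up to
   [C + D' * (1 + t * Z + g * Z ^+ 2)]. *)
have := sle_add_le hE H23 H1 E23 E1; rewrite add0e; apply: le_trans.
apply: (sle_monotone hE); first exact: (rvs_add hH).
  apply: (rvs_add hH) => //; apply: (rvs_mul hH) => //; apply: (rvs_mul hH) => //.
  apply: (rvs_expR hH (M := t * y)).
    by apply: (rvs_scale hH); exact: (rvs_minr hH).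
  by move=> w; rewrite ler_wpM2l ?(ltW t0)// ge_min lexx orbT.
move=> w.
have := ler_wpM2l (D'0 w) (expR_minr_le (Z w) t0 y0); rewrite -/g.
rewrite -/(W w) -/(F w).
have -> : D w * (expR (t * Num.min (Z w) y) * F w) =
  D' w * expR (t * Num.min (Z w) y) by rewrite /D'; ring.
lra.
Qed.

End ConditionalExpectation.

(** * Stopping and the exponential inequality *)

(** The default value [-oo] lies below every real, so for [K = 0] both sides are false. *)
Lemma le_bigmaxe_natP (R : realType) (K : nat) (x : R) (f : nat -> R) :
  (x%:E <= \big[maxe/-oo]_(1 <= m < K.+1) (f m)%:E)%E <->
  exists2 m, (1 <= m <= K)%N & x <= f m.
Proof.
rewrite big_add1 /= big_mkord; split.
  by move=> /bigmax_geP[//|[i _ xi]]; exists i.+1 => //=.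
move=> [[//|m] /= mK xm]; apply/bigmax_geP; right.
by exists (Ordinal mK).
Qed.

(* Randomised stopping of the product of the [a i]: after step [j] one goes on
   with probability [c j]. The mass stopped so far is [stopped_sum], the mass
   still running is [live_prod]. *)
Definition live_prod (R : realType) (a c : nat -> R) (m : nat) : R :=
  \prod_(1 <= i < m.+1) (a i * c i).

Definition stopped_sum (R : realType) (a c : nat -> R) (m : nat) : R :=
  \sum_(1 <= j < m.+1) live_prod a c j.-1 * (a j * (1 - c j)).

Section Stopping.
Context {R : realType} (a c : nat -> R).

Lemma live_prod0 : live_prod a c 0 = 1.
Proof. by rewrite /live_prod big_geq. Qed.

Lemma stopped_sum0 : stopped_sum a c 0 = 0.
Proof. by rewrite /stopped_sum big_geq. Qed.

Lemma live_prodS m : live_prod a c m.+1 = live_prod a c m * (a m.+1 * c m.+1).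
Proof. by rewrite /live_prod big_nat_recr. Qed.

Lemma stopped_sumS m : stopped_sum a c m.+1 =
  stopped_sum a c m + live_prod a c m * (a m.+1 * (1 - c m.+1)).
Proof. by rewrite /stopped_sum big_nat_recr. Qed.

(** The weight of the product of the first [j] factors in [stopped_sum] is the probability of
    stopping at step [j]. These weights telescope to [1 - \prod c], and those with [c j = 1] vanish,
    so [L] has to be a lower bound only where stopping can occur. *)
Lemma stopped_sum_ge (L : R) (m : nat) :
  (forall j, 0 <= c j <= 1) ->
  (forall j, (1 <= j <= m)%N -> c j < 1 -> L <= \prod_(1 <= i < j.+1) a i) ->
  L * (1 - \prod_(1 <= j < m.+1) c j) <= stopped_sum a c m.
Proof.
move=> c01; elim: m => [_|m IH aL].
  by rewrite stopped_sum0 big_geq// subrr mulr0.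
rewrite stopped_sumS big_nat_recr//= /live_prod big_split/=.
have {}IH : L * (1 - \prod_(1 <= j < m.+1) c j) <= stopped_sum a c m.
  by apply: IH => j /andP[j1 jm]; apply: aL; rewrite j1 ltnW.
have := aL m.+1; rewrite ltnSn big_nat_recr//= => /(_ isT) h.
set P := \prod_(1 <= i < m.+1) c i in IH *.
set Q := \prod_(1 <= i < m.+1) a i in h *.
have P0 : 0 <= P by apply: prodr_ge0 => j _; have /andP[] := c01 j.
have /andP[c0 c1] := c01 m.+1.
have {}h : L * (P * (1 - c m.+1)) <= Q * a m.+1 * (P * (1 - c m.+1)).
  have [cl|cg] := ltP (c m.+1) 1.
    by rewrite ler_wpM2r ?h// mulr_ge0// subr_ge0.
  have -> : c m.+1 = 1 by apply/eqP; rewrite eq_le c1.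
  by rewrite subrr !mulr0.
lra.
Qed.

End Stopping.

(** * The exponential inequality for one row of the array *)

Section FreedmanInequality.
Context {R : realType} {Omega : Type} {H : set (Omega -> R)}.
Context {E : (Omega -> R) -> \bar R} (hE : sublinear_expectation_space H E).
Context {K : nat} {F : nat -> set (Omega -> R)}.
Context {EF : nat -> (Omega -> R) -> Omega -> R} {Z : nat -> Omega -> R}.
Context (hF : forall k, (k <= K)%N -> rv_subspace H (F k)).
Context (F_nested : forall k, (k < K)%N -> F k `<=` F k.+1).
Context (hEF : forall k, (k <= K)%N -> cond_expectation H E (F k) (EF k)).
Context (FZ : forall k, (1 <= k <= K)%N -> F k (Z k)).
Context (Z2 : forall k, (1 <= k <= K)%N -> (E (fun w => (Z k w ^+ 2)%R) < +oo)%E).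
Context (Z_super : forall k, (1 <= k <= K)%N -> le_L1 E (EF k.-1 (Z k)) (cst 0)).
Context {x y A t : R} (y0 : 0 < y) (t0 : 0 < t).

Let hH := sle_rv_subspace hE.
Let g := (expR (t * y) - 1 - t * y) / y ^+ 2.
Let S m w := \sum_(1 <= k < m.+1) Z k w.
Let V k := EF k.-1 (fun v => Z k v ^+ 2).
(** [V k] may take negative values; using its positive part keeps the factor bounded by
    [expR (t * y)]. *)
Let a w k := expR (t * Num.min (Z k w) y) * expR (- (g * Num.max (V k w) 0)).
(* a Lipschitz version of the indicator of [S k w < x] *)
Let c (e : R) w k := Num.max (Num.min (e^-1 * (x - S k w)) 1) 0.

Let g0 : 0 <= g.
Proof.
rewrite divr_ge0 ?exprn_ge0 ?(ltW y0)//.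
by have := expR_ge1Dx (t * y); lra.
Qed.

Let a_ge0 w k : 0 <= a w k.
Proof. by rewrite mulr_ge0 ?expR_ge0. Qed.

Let a_le w k : a w k <= expR (t * y).
Proof.
rewrite -[leRHS]mulr1 ler_pM ?expR_ge0// ?ler_expR.
  by rewrite ler_wpM2l ?(ltW t0)// ge_min lexx orbT.
by rewrite -expR0 ler_expR oppr_le0 mulr_ge0// le_max lexx orbT.
Qed.

Let c01 e w k : 0 <= c e w k <= 1.
Proof. by rewrite /c le_max lexx orbT ge_max ge_min lexx ler01 orbT. Qed.

Let FV k : (1 <= k <= K)%N -> F k.-1 (V k).
Proof.
case: k => // k /= kK; have k1 : (1 <= k.+1 <= K)%N by [].
have HZ : H (Z k.+1) by exact: (rvs_sub (hF kK) (FZ k1)).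
have [_ IZ2] := integrable_part_sqr hE HZ (Z2 k1).
by have [] := ce_range (hEF (ltnW kK)) IZ2.
Qed.

Let FS k : (k <= K)%N -> F k (S k).
Proof.
elim: k => [_|k IH kK].
  have := rvs_cst (hF (leq0n K)) 0; congr F; apply/funext => w.
  by rewrite /S big_geq.
have -> : S k.+1 = (fun w => S k w + Z k.+1 w).
  by apply/funext => w; rewrite /S big_nat_recr.
by apply: (rvs_add (hF kK)); [apply: F_nested => //; exact: IH (ltnW kK)|exact: FZ].
Qed.

Let Fc e k : (k <= K)%N -> F k (fun w => c e w k).
Proof.
move=> kK; apply: (rvs_maxr (hF kK)); apply: (rvs_minr (hF kK)).
apply: (rvs_scale (hF kK)); apply: (rvs_diff (hF kK)); last exact: FS.
exact: (rvs_cst (hF kK)).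
Qed.

Let Fa k : (k < K)%N -> F k.+1 (fun w => a w k.+1).
Proof.
move=> kK; have k1 : (1 <= k.+1 <= K)%N by [].
have hFk := hF kK; apply: (rvs_mul hFk).
  apply: (rvs_expR hFk (M := t * y)).
    by apply: (rvs_scale hFk); apply: (rvs_minr hFk); exact: FZ.
  by move=> w; rewrite ler_wpM2l ?(ltW t0)// ge_min lexx orbT.
apply: (rvs_expR hFk (M := 0)).
  apply: (rvs_opp hFk); apply: (rvs_scale hFk); apply: (rvs_maxr hFk).
  by apply: F_nested => //; exact: (FV k1).
by move=> w; rewrite oppr_le0 mulr_ge0// le_max lexx orbT.
Qed.

Let live_bound e m w : 0 <= live_prod (a w) (c e w) m <= expR (t * y) ^+ m.
Proof.
elim: m => [|m /andP[l0 lB]]; first by rewrite live_prod0 ler01 expr0 lexx.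
have /andP[c0 c1] := c01 e w m.+1.
rewrite live_prodS mulr_ge0 ?mulr_ge0//= exprSr ler_pM ?mulr_ge0//.
by apply: le_trans (a_le w m.+1); rewrite ler_piMr.
Qed.

(** Induction on [m], with [supermartingale_step] applied to the stopped mass as the additive term
    and the live mass as the bounded weight. The memberships and the integrability are carried along
    as its hypotheses. *)
Lemma stopped_expectation_le1 e m : (m <= K)%N ->
  [/\ F m (fun w => live_prod (a w) (c e w) m),
      F m (fun w => stopped_sum (a w) (c e w) m),
      integrable_part H E (fun w => stopped_sum (a w) (c e w) m) &
      (E (fun w => stopped_sum (a w) (c e w) m + live_prod (a w) (c e w) m)%R
         <= 1%:E)%E].
Proof.
elim: m => [_|m IH mK].
  have -> : (fun w => live_prod (a w) (c e w) 0) = cst 1.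
    by apply/funext => w; rewrite live_prod0.
  have -> : (fun w => stopped_sum (a w) (c e w) 0) = cst 0.
    by apply/funext => w; rewrite stopped_sum0.
  have -> : (fun w => stopped_sum (a w) (c e w) 0 + live_prod (a w) (c e w) 0) =
      cst 1.
    by apply/funext => w; rewrite stopped_sum0 live_prod0 add0r.
  rewrite (sle_cst hE); split => //; try exact: (rvs_cst (hF (leq0n K))).
  by apply: (integrable_part_bounded hE (c := 0) (rvs_cst hH 0)) => w; rewrite normr0.
have [Fl Fs Is El] := IH (ltnW mK).
have Fl1 := F_nested mK Fl; have Fs1 := F_nested mK Fs.
have hF1 := hF mK; have Fa1 := Fa mK; have Fc1 := Fc e mK.
have m1 : (1 <= m.+1 <= K)%N by [].
have F1c : F m.+1 (fun w => 1 - c e w m.+1).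
  by apply: (rvs_diff hF1) => //; exact: (rvs_cst hF1).
have lS : (fun w => live_prod (a w) (c e w) m.+1) =
    (fun w => live_prod (a w) (c e w) m * (a w m.+1 * c e w m.+1)).
  by apply/funext => w; rewrite live_prodS.
have sS : (fun w => stopped_sum (a w) (c e w) m.+1) =
    (fun w => stopped_sum (a w) (c e w) m +
              live_prod (a w) (c e w) m * (a w m.+1 * (1 - c e w m.+1))).
  by apply/funext => w; rewrite stopped_sumS.
have Fac : F m.+1 (fun w => live_prod (a w) (c e w) m * (a w m.+1 * (1 - c e w m.+1))).
  by do 2 apply: (rvs_mul hF1) => //.
split.
- by rewrite lS; do 2 apply: (rvs_mul hF1) => //.
- by rewrite sS; apply: (rvs_add hF1).
- rewrite sS; apply: (integrable_part_add hE) => //.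
  apply: (integrable_part_bounded hE (c := expR (t * y) ^+ m * expR (t * y))).
    exact: (rvs_sub hF1 Fac).
  move=> w; have /andP[l0 lB] := live_bound e m w.
  have /andP[c0 c1] := c01 e w m.+1.
  rewrite ger0_norm; last by rewrite !mulr_ge0// subr_ge0.
  rewrite ler_pM ?mulr_ge0 ?subr_ge0//.
  by apply: le_trans (a_le w m.+1); rewrite ler_piMr// gerBl.
- apply: le_trans El.
  (* The shares [c] and [1 - c] recombine, so the stopping rule at step [m.+1] drops out of the
     total. *)
  have -> : (fun w => stopped_sum (a w) (c e w) m.+1 + live_prod (a w) (c e w) m.+1) =
      (fun w => stopped_sum (a w) (c e w) m + live_prod (a w) (c e w) m * a w m.+1).
    by apply/funext => w; rewrite stopped_sumS live_prodS; ring.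
  apply: (supermartingale_step hE (hF (ltnW mK)) (hEF (ltnW mK)) t0 y0
    (rvs_sub hF1 (FZ m1)) (Z2 m1) (Z_super m1) Fs Is Fl).
  exact: live_bound.
Qed.

Let compensator_neg k w : R := Num.max (- V k w) 0.

(** Since [x <= S m w], the factor [c e w m] is [0] and all the mass has been stopped by time [m].
    Mass is stopped only at times [j] with [x - e <= S j w], where the running product is at least
    the stated exponential. *)
Lemma stopped_sum_ge_level (e : R) w m : 0 < e -> (1 <= m <= K)%N ->
  x <= S m w ->
  (forall k, (1 <= k <= K)%N -> Z k w < y) ->
  \sum_(1 <= k < K.+1) V k w < A ->
  (forall k, (1 <= k <= K)%N -> compensator_neg k w < e / K%:R) ->
  expR (t * (x - e) - g * (A + e)) <= stopped_sum (a w) (c e w) K.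
Proof.
move=> e0 /andP[m1 mK] xS Zy VA Ve.
set L := expR _.
have cm : c e w m = 0.
  rewrite /c max_r// ge_min; apply/orP; left.
  by rewrite pmulr_rle0 ?invr_gt0// subr_le0.
have -> : L = L * (1 - \prod_(1 <= j < K.+1) c e w j).
  rewrite (big_cat_nat (n := m.+1))//= ?ltnS// big_nat_recr//= cm.
  by rewrite mulr0 mul0r subr0 mulr1.
apply: stopped_sum_ge => // j /andP[j1 jK] cj.
have Sj : x - e <= S j w.
  rewrite leNgt; apply/negP => Sj; move: cj; rewrite ltNge => /negP; apply.
  rewrite /c le_max; apply/orP; left; rewrite le_min lexx andbT.
  by rewrite -(mulVf (lt0r_neq0 e0)) ler_wpM2l ?invr_ge0 ?(ltW e0)//; lra.
(* Only the full sum of the [V k] is controlled, so positive parts are taken before the range is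
   extended to [K]; each of them exceeds [V k w] by at most [e / K]. *)
have SV : \sum_(1 <= k < j.+1) Num.max (V k w) 0 <= A + e.
  apply: (@le_trans _ _ (\sum_(1 <= k < K.+1) Num.max (V k w) 0)).
    rewrite [leRHS](big_cat_nat (n := j.+1))//= ?ltnS// lerDl.
    by rewrite sumr_ge0// => k _; rewrite le_max lexx orbT.
  apply: (@le_trans _ _ (\sum_(1 <= k < K.+1) (V k w + e / K%:R))).
    rewrite !big_nat; apply: ler_sum => k kK; have := Ve k kK.
    rewrite /compensator_neg gt_max => /andP[h1 h2].
    rewrite ge_max; apply/andP; split; first by rewrite lerDl ltW.
    by move: h1; lra.
  have K0 : K%:R != 0 :> R by rewrite pnatr_eq0 -lt0n (leq_trans j1).
  rewrite big_split/= sumr_const_nat subSS subn0 -(mulr_natr (e / K%:R)) divfK//.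
  by rewrite lerD2r ltW.
have -> : \prod_(1 <= i < j.+1) a w i =
    expR (t * S j w - g * \sum_(1 <= k < j.+1) Num.max (V k w) 0).
  rewrite expRD /S !mulr_sumr -sumrN !expR_sum -big_split/=.
  rewrite big_nat [RHS]big_nat; apply: eq_bigr => k /andP[k1 kj].
  by rewrite /a min_l// ltW// Zy// k1 (leq_trans _ jK).
rewrite ler_expR lerB//.
  by rewrite ler_wpM2l// ltW.
by rewrite ler_wpM2l.
Qed.

(** The event is covered by the sum of [xi], of variables of nonpositive expectation that handle
    negative conditional variances, and of the stopped sum divided by its guaranteed level
    [expR L]. *)
Lemma capacity_max_sum_le (e : R) (xi : Omega -> R) : 0 < e -> H xi ->
  (forall w, \1_[set w : Omega | (exists2 k, (1 <= k <= K)%N & y <= Z k w) \/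
                 A <= \sum_(1 <= k < K.+1) V k w] w <= xi w) ->
  (capacity H E [set w : Omega | exists2 m, (1 <= m <= K)%N & (x <= S m w)%R]
   <= E xi + (expR (- (t * (x - e) - g * (A + e))))%:E)%E.
Proof.
move=> e0 Hxi hxi; set L := t * (x - e) - _.
have [_ Fs Is Es] := stopped_expectation_le1 e (leqnn K).
have [Fl _ _ _] := stopped_expectation_le1 e (leqnn K).
set s := (fun w => stopped_sum _ _ _) in Fs Is.
have Hs : H s by exact: Is.1.
have s0 w : 0 <= s w.
  rewrite /s /stopped_sum big_nat sumr_ge0// => j _.
  have /andP[l0 _] := live_bound e j.-1 w; have /andP[c0 c1] := c01 e w j.
  by rewrite !mulr_ge0// subr_ge0.
(* The mass still live at time [K] is nonnegative and is dropped. *)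
have Es1 : (E s <= 1%:E)%E.
  apply: le_trans Es; apply: (sle_monotone hE) => //.
    by apply: (rvs_add hH) => //; exact: (rvs_sub (hF (leqnn K)) Fl).
  by move=> w; rewrite lerDl; have /andP[] := live_bound e K w.
(* [b k] equals [1] where [V k] is at most [- e / K]. *)
pose b k w := Num.min ((e / K%:R)^-1 * compensator_neg k w) 1.
have b0 k w : 0 <= b k w.
  rewrite le_min ler01 mulr_ge0 ?invr_ge0 ?divr_ge0 ?ler0n ?(ltW e0)//.
  by rewrite le_max lexx orbT.
have Hneg k : (1 <= k <= K)%N -> H (compensator_neg k).
  move=> kK; apply: (rvs_maxr hH); apply: (rvs_opp hH).
  have k1 : (k.-1 <= K)%N by apply: leq_trans (leq_pred _) _; case/andP: kK.
  exact: (rvs_sub (hF k1) (FV kK)).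
have Hb k : (1 <= k <= K)%N -> H (b k).
  by move=> kK; apply: (rvs_minr hH); apply: (rvs_scale hH); exact: Hneg.
have Eb k : (1 <= k <= K)%N -> (E (b k) <= 0)%E.
  move=> kK; have K0 : (0 < K)%N by case/andP: kK; exact: leq_trans.
  apply: (expectation_min_eq0 hE); rewrite ?divr_gt0 ?ltr0n//; first exact: Hneg.
    by move=> w; rewrite le_max lexx orbT.
  have k1 : (k.-1 <= K)%N by apply: leq_trans (leq_pred _) _; case/andP: kK.
  have HZ : H (Z k) by apply: (rvs_sub (hF _) (FZ kK)); case/andP: kK.
  have [_ IZ2] := integrable_part_sqr hE HZ (Z2 kK).
  by apply: (cond_expectation_ge0 hE (hF k1) (hEF k1) IZ2) => w; rewrite sqr_ge0.
have Hsum n : (n <= K)%N -> H (fun w => \sum_(1 <= k < n.+1) b k w).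
  move=> nK; apply: (rvs_sum hH) => k /andP[k1 kn].
  by apply: Hb; rewrite k1 (leq_trans _ nK).
have Esum n : (n <= K)%N -> (E (fun w => \sum_(1 <= k < n.+1) b k w)%R <= 0)%E.
  elim: n => [_|n IH nK].
    have -> : (fun w => \sum_(1 <= k < 1) b k w) = cst 0.
      by apply/funext => w; rewrite big_geq.
    by rewrite (sle_cst hE).
  have -> : (fun w => \sum_(1 <= k < n.+2) b k w) =
      (fun w => \sum_(1 <= k < n.+1) b k w + b n.+1 w).
    by apply/funext => w; rewrite big_nat_recr.
  have := sle_add_le hE (Hsum n (ltnW nK)) (Hb n.+1 _) (IH (ltnW nK)) (Eb n.+1 _).
  by rewrite add0e; apply.
have HLs : H (fun w => expR (- L) * s w) by exact: (rvs_scale hH).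
have ELs : (E (fun w => expR (- L) * s w)%R <= (expR (- L))%:E)%E.
  rewrite (sle_homogeneous hE) ?expR_ge0// -[leRHS]mule1.
  by rewrite lee_wpmul2l// lee_fin expR_ge0.
have HsL := rvs_add hH (Hsum K (leqnn K)) HLs.
have EsL := sle_add_le hE (Hsum K (leqnn K)) HLs (Esum K (leqnn K)) ELs.
rewrite add0e in EsL.
have := sle_add_le hE HsL Hxi EsL (lexx _); rewrite addeC; apply: le_trans.
apply: ereal_inf_lbound; eexists; last reflexivity.
split; first exact: (rvs_add hH HsL Hxi).
move=> w /=; have xi0 : 0 <= xi w by apply: le_trans (hxi w); rewrite indicE ler0n.
have sum0 : 0 <= \sum_(1 <= k < K.+1) b k w by rewrite sumr_ge0.
have Ls0 : 0 <= expR (- L) * s w by rewrite mulr_ge0 ?expR_ge0.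
rewrite indicE; have [|_] := boolP (w \in _); last by rewrite !addr_ge0.
rewrite inE /= => -[m mK xS].
set B := (X in \1_X) in hxi.
(* Three cases, in each of which one summand of the cover is at least [1]: [xi] on the exceptional
   event, some [b k] if a conditional variance is too negative, the rescaled [s] otherwise. *)
have [Bw|nBw] := pselect (B w).
  have := hxi w; rewrite indicE mem_set//= => xi1.
  by apply: le_trans xi1 _; rewrite lerDr addr_ge0.
have [[k kK ek]|neg] := pselect (exists2 k, (1 <= k <= K)%N &
    e / K%:R <= compensator_neg k w).
  have K0 : (0 < K)%N by case/andP: kK; exact: leq_trans.
  have eK : 0 < e / K%:R by rewrite divr_gt0 ?ltr0n.
  have bk : b k w = 1.
    rewrite /b min_r// -[leLHS](mulVf (lt0r_neq0 eK)).
    by rewrite ler_wpM2l// invr_ge0 ltW.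
  have : 1 <= \sum_(1 <= k < K.+1) b k w.
    rewrite (bigD1_seq k) ?iota_uniq//=; last by rewrite mem_index_iota ltnS.
    by rewrite bk lerDl sumr_ge0.
  lra.
have sL : expR L <= s w.
  apply: (stopped_sum_ge_level (m := m) e0 mK xS).
  - by move=> k kK; rewrite ltNge; apply/negP => yZ; apply: nBw; left; exists k.
  - by rewrite ltNge; apply/negP => AV; apply: nBw; right.
  - by move=> k kK; rewrite ltNge; apply/negP => ek; apply: neg; exists k.
have : 1 <= expR (- L) * s w.
  by rewrite -[leLHS](expRxMexpNx_1 L) mulrC ler_wpM2l ?expR_ge0.
lra.
Qed.

End FreedmanInequality.

Theorem theorem4p2 (R : realType) (d : measure_display)
    (Omega : measurableType d)
    (H : set (Omega -> R)) (E : (Omega -> R) -> \bar R)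
    (kn : nat -> nat)
    (Hn : nat -> nat -> set (Omega -> R))
    (En : nat -> nat -> (Omega -> R) -> Omega -> R)
    (Z : nat -> nat -> Omega -> R) (n : nat)
    (hE : sublinear_expectation_space H E)
    (hHn : forall k : nat, (k <= kn n)%N -> rv_subspace H (Hn n k))
    (hHn_nested : forall k : nat, (k < kn n)%N -> Hn n k `<=` Hn n k.+1)
    (hEn : forall k : nat, (k <= kn n)%N ->
      cond_expectation H E (Hn n k) (En n k))
    (hZ : forall k : nat, (1 <= k <= kn n)%N -> Hn n k (Z n k))
    (hZ2 : forall k : nat, (1 <= k <= kn n)%N ->
      (E (fun w => (Z n k w ^+ 2)%R) < +oo)%E)
    (hZ_super : forall k : nat, (1 <= k <= kn n)%N ->
      le_L1 E (En n k.-1 (Z n k)) (cst 0))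
    (x y A : R) (hx : 0 < x) (hy : 0 < y) (hA : 0 < A) :
  (capacity H E
     [set w | x%:E <= \big[maxe/-oo]_(1 <= m < (kn n).+1)
                        (\sum_(1 <= k < m.+1) Z n k w)%R%:E]
   <= capacity H E
        [set w | y%:E <= \big[maxe/-oo]_(1 <= k < (kn n).+1) (Z n k w)%:E \/
                 (A <= \sum_(1 <= k < (kn n).+1)
                         En n k.-1 (fun v => Z n k v ^+ 2) w)%R]
      + (expR (- (x ^+ 2 / (2 * (x * y + A))
                  * (1 + 2 / 3 * ln (1 + x * y / A)))))%:E)%E.
Proof.
have u0 : 0 < x * y / A by rewrite divr_gt0// mulr_gt0.
(* The minimiser over [t] of the exponent [b] below. *)
pose t := ln (1 + x * y / A) / y.
have t0 : 0 < t by rewrite divr_gt0// ln_gt0// ltrDl.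
set g := (expR (t * y) - 1 - t * y) / y ^+ 2.
have g0 : 0 <= g.
  rewrite divr_ge0 ?exprn_ge0 ?(ltW hy)//.
  by have := expR_ge1Dx (t * y); lra.
pose b := - (t * x) + g * A.
have bennett : expR b <= expR (- (x ^+ 2 / (2 * (x * y + A))
    * (1 + 2 / 3 * ln (1 + x * y / A)))).
  by rewrite ler_expR; exact: bennett_exponent_le.
(* Moving the finite exponential to the left leaves a lower bound for an infimum, to be checked for
   each cover [xi] of the exceptional event. *)
rewrite -leeBlDr//; apply: le_ereal_inf_tmp => _ [xi [Hxi hxi] <-].
rewrite leeBlDr//; apply/lee_addgt0Pr => eps eps0.
have eb0 : 0 < eps / expR b by rewrite divr_gt0 ?expR_gt0.
(* The width of the stopping zone is chosen so that [expR (b + e * (t + g))] equals [expR b + eps]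
   exactly. *)
pose e := ln (1 + eps / expR b) / (t + g).
have tg0 : 0 < t + g by rewrite ltr_pwDl.
have e0 : 0 < e by rewrite divr_gt0// ln_gt0// ltrDl.
have -> : [set w | (x%:E <= \big[maxe/-oo]_(1 <= m < (kn n).+1)
      (\sum_(1 <= k < m.+1) Z n k w)%R%:E)%E] =
    [set w : Omega | exists2 m, (1 <= m <= kn n)%N &
      x <= \sum_(1 <= k < m.+1) Z n k w].
  by apply/funext => w; apply/propext; exact: le_bigmaxe_natP.
have {}hxi w : \1_[set w | (exists2 k, (1 <= k <= kn n)%N & y <= Z n k w) \/
    A <= \sum_(1 <= k < (kn n).+1) En n k.-1 (fun v => Z n k v ^+ 2) w] w <= xi w.
  apply: le_trans (hxi w); rewrite le_eqVlt; apply/orP; left; apply/eqP.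
  congr (\1_ _ w); apply/funext => v; apply/propext.
  by split=> -[/le_bigmaxe_natP|]; [left|right|left|right].
apply: (le_trans (capacity_max_sum_le hE hHn hHn_nested hEn hZ hZ2 hZ_super
  hy t0 e0 Hxi hxi)).
rewrite -addeA leeD2l// -EFinD lee_fin -/g.
have -> : - (t * (x - e) - g * (A + e)) = b + e * (t + g) by rewrite /b; ring.
rewrite expRD divfK ?gt_eqF// lnK ?posrE ?addr_gt0// mulrDr mulr1.
by rewrite mulrCA divff ?gt_eqF ?expR_gt0// mulr1 lerD2r.
Qed.
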